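(* Let $A\in\mathbb{R}^{m\times n}$, $b\in\mathbb{R}^m$, $c\in\mathbb{R}^n$ be LP data satisfying the Assumption in the context. Suppose $x_a\in\mathcal{X}^\star$ and $R_a$ is such that $\mathcal{X}^\star\subset\{x:\|x-x_a\|\le R_a\}$. Then $\theta_p^\star\le G^\star$, where $$G^\star:=\inf_{r>0,\ x\in\mathbb{R}^n}\ \frac{R_a+\|x-x_a\|}{r}\quad\text{s.t.}\quad x\in V_p,\ x\ge r\cdot e .$$ Furthermore, since $V_p=\{\hat x\in\mathbb{R}^n:A\hat x=b\}$, $$G^\star=\min_{v\in\mathbb{R}^n,\ \alpha\in\mathbb{R}}\ R_a\alpha+\|v-\alpha x_a\|\quad\text{s.t.}\quad Av=\alpha b,\ v\ge e,\ \alpha\ge0 .$$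
   Context: Norms are Euclidean, $\operatorname{Dist}$ is Euclidean distance to a set, $e=(1,\dots,1)^\top$, inequalities between vectors are componentwise, and the infimum (minimum) over an empty set is $+\infty$. Primal LP: $\min c^\top x$ s.t. $Ax=b$, $x\ge0$, with dual $\max b^\top y$ s.t. $A^\top y+s=c,\ s\ge0$. $V_p:=\{x\in\mathbb{R}^n:Ax=b\}$, $\mathcal{F}_p:=V_p\cap\mathbb{R}^n_+$, $\mathcal{X}^\star$ is the set of optimal primal solutions. Assumption: the primal has an optimal solution, and both the primal and the dual have feasible solutions that are not optimal (for the dual, in the slack variable $s$). Limiting error ratio: for $x\in V_p\setminus\mathcal{F}_p$, $\theta_p(x):=\operatorname{Dist}(x,\mathcal{F}_p)/\operatorname{Dist}(x,\mathbb{R}^n_+)$, and $\theta_p(x):=1$ for $x\in\mathcal{F}_p$; $\theta_p^\star:=\lim_{\epsilon\to0}\sup\{\theta_p(x):x\in V_p,\ \operatorname{Dist}(x,\mathcal{X}^\star)\le\epsilon\}$. *)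

(* Defs.v *)
From HB Require Import structures.
From mathcomp Require Import all_boot all_order all_algebra.
From mathcomp Require Import all_classical all_reals all_analysis.
Set Implicit Arguments.
Unset Strict Implicit.
Unset Printing Implicit Defensive.
Import Order.TTheory GRing.Theory Num.Theory.
Import numFieldNormedType.Exports.
Local Open Scope classical_set_scope.
Local Open Scope ring_scope.

(* The library's norm on matrices is the sup norm, hence a separate
   definition of the Euclidean norm. *)
Definition enorm (R : realType) (n : nat) (x : 'cV[R]_n) : R :=
  Num.sqrt (\sum_(i < n) x i ord0 ^+ 2).

(* Extended-real valued, so that the distance to set0 is +oo. *)
Definition Dist (R : realType) (n : nat) (x : 'cV[R]_n) (S : set 'cV[R]_n) :
    \bar R :=
  ereal_inf [set (enorm (x - y))%:E | y in S].

Definition lev (R : realType) (n : nat) (x y : 'cV[R]_n) : Prop :=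
  forall i, x i ord0 <= y i ord0.

Definition ones (R : realType) (n : nat) : 'cV[R]_n := const_mx 1.

Definition dotv (R : realType) (n : nat) (u v : 'cV[R]_n) : R :=
  (u^T *m v) ord0 ord0.

Definition orthant (R : realType) (n : nat) : set 'cV[R]_n :=
  [set x | lev 0 x].

(* v is the minimum of S, with min set0 = +oo; if S is nonempty the minimum
   has to be attained. *)
Definition is_emin (R : realType) (S : set (\bar R)) (v : \bar R) : Prop :=
  (S = set0 /\ v = +oo%E) \/ (S v /\ lbound S v).

Section LP.
Variables (R : realType) (m n : nat).
Variables (A : 'M[R]_(m, n)) (b : 'cV[R]_m) (c : 'cV[R]_n).

Definition Vp : set 'cV[R]_n := [set x | A *m x = b].

Definition Fp : set 'cV[R]_n := Vp `&` @orthant R n.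

Definition Xstar : set 'cV[R]_n :=
  [set x | Fp x /\ forall z, Fp z -> dotv c x <= dotv c z].

Definition dual_feasible (y : 'cV[R]_m) (s : 'cV[R]_n) : Prop :=
  A^T *m y + s = c /\ lev 0 s.

Definition dual_optimal (y : 'cV[R]_m) (s : 'cV[R]_n) : Prop :=
  dual_feasible y s /\
  forall y' s', dual_feasible y' s' -> dotv b y' <= dotv b y.

Definition Fd : set 'cV[R]_n := [set s | exists y, dual_feasible y s].

Definition Sstar : set 'cV[R]_n := [set s | exists y, dual_optimal y s].

Definition lp_assumption : Prop :=
  [/\ Xstar !=set0, (Fp `\` Xstar) !=set0 & (Fd `\` Sstar) !=set0].

(* Only meaningful for x in Vp. For x in Vp outside Fp the denominator is
   positive and finite. *)
Definition theta_p (x : 'cV[R]_n) : \bar R :=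
  if x \in Fp then 1%E else (Dist x Fp / Dist x (@orthant R n))%E.

Definition theta_sup (eps : R) : \bar R :=
  ereal_sup [set theta_p x | x in [set x | Vp x /\ (Dist x Xstar <= eps%:E)%E]].

(* theta_sup is nondecreasing, so that the limit below always exists. *)
Lemma is_cvg_theta_sup : cvg (theta_sup eps @[eps --> 0^'+]).
Proof.
apply: (@nondecreasing_at_right_is_cvge _ theta_sup 0).
near=> z => u v _ _ uv; apply: ereal_sup_le => _ [x [Vx xu] <-].
exists x => //; split=> //.
by apply: (le_trans xu); rewrite lee_fin.
Unshelve. all: by end_near. Qed.

Definition theta_star : \bar R := lim (theta_sup eps @[eps --> 0^'+]).

Definition Gstar (xa : 'cV[R]_n) (Ra : R) : \bar R :=
  ereal_inf [set g | exists r x,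
    [/\ 0 < r, Vp x, lev (r *: ones R n) x
      & g = ((Ra + enorm (x - xa)) / r)%:E]].

Definition Gstar_min_values (xa : 'cV[R]_n) (Ra : R) : set (\bar R) :=
  [set g | exists v alpha,
    [/\ A *m v = alpha *: b, lev (ones R n) v, 0 <= alpha
      & g = (Ra * alpha + enorm (v - alpha *: xa))%:E]].

End LP.

(* Main.v *)
Require Import Defs.
From mathcomp Require Import all_boot all_order all_algebra.
From mathcomp Require Import all_classical all_reals all_analysis.
From mathcomp Require Import ring lra.
Import Order.TTheory GRing.Theory Num.Theory.
Import numFieldNormedType.Exports.
Local Open Scope classical_set_scope.
Local Open Scope ring_scope.

(** Fix xh in the affine space with xh >= r e, r > 0.  If x lies in the affine
    space and all its negative entries are at least - d, where d is the
    distance of x to the orthant, then moving from x towards xh by the fraction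
    d / (r + d) makes x nonnegative.  Hence Dist(x, F_p) is at most
    (d / r) |x - xh|, and the error ratio at x is at most |x - xh| / r
    ([theta_p_le]).  Near the optimal set, |x - xh| is at most
    R_a + |xh - x_a| up to an error that vanishes in the limit.

    At feasible points the ratio is 1 by convention, so the bound also needs
    R_a + |xh - x_a| >= r.  This is where the existence of a feasible
    non-optimal point enters: an optimal point with positive entries only would
    be interior to the orthant, the objective would be constant on the feasible
    set, and every feasible point would be optimal
    ([positive_optimum_all_optimal]).  So x_a has a zero entry, at which xh
    exceeds it by at least r.

    For the second formula, alpha = 1 / r and v = x / r turn the values defining
    G* into those of the homogenized program with alpha > 0.  A point (v, 0) is
    a direction v in the kernel of A, and following it from x_a shows that its
    value is a limit of admissible values ([Gstar_inf_min_values]).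

    Attainment ([Gstar_min_attained]) is delicate when R_a = 0, since then the
    objective does not control alpha.  In the coordinates w = v - alpha x_a the
    constraints read A w = 0 and w + alpha x_a >= e, and the objective is
    R_a alpha + |w|.  As x_a >= 0, increasing alpha only relaxes the
    constraints, and on bounded w a certain K makes all constraints with
    (x_a)_i > 0 hold; so alpha may be cut down to at most K without raising
    the objective.  What remains is a continuous function on a compact set. *)

(** * The Euclidean norm *)

Lemma enorm_ge0 (R : realType) (n : nat) (x : 'cV[R]_n) : 0 <= enorm x.
Proof. exact: sqrtr_ge0. Qed.

Lemma enorm_sqr (R : realType) (n : nat) (x : 'cV[R]_n) :
  enorm x ^+ 2 = \sum_(i < n) x i ord0 ^+ 2.
Proof. by rewrite sqr_sqrtr// sumr_ge0// => i _; exact: sqr_ge0. Qed.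

Lemma coord_le_enorm (R : realType) (n : nat) (x : 'cV[R]_n) i :
  `|x i ord0| <= enorm x.
Proof.
rewrite -(@ler_pXn2r _ 2)// ?nnegrE ?enorm_ge0// enorm_sqr real_normK ?num_real//.
by rewrite (bigD1 i)//= lerDl sumr_ge0// => j _; exact: sqr_ge0.
Qed.

Lemma enormZ (R : realType) (n : nat) (a : R) (x : 'cV[R]_n) :
  enorm (a *: x) = `|a| * enorm x.
Proof.
rewrite /enorm -sqrtr_sqr -sqrtrM ?sqr_ge0//; congr Num.sqrt.
by rewrite mulr_sumr; apply: eq_bigr => i _; rewrite mxE exprMn.
Qed.

Lemma enormB_sym (R : realType) (n : nat) (x y : 'cV[R]_n) :
  enorm (x - y) = enorm (y - x).
Proof. by rewrite -opprB -scaleN1r enormZ normrN1 mul1r. Qed.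

(** Expanding the sum of squares of |y| x_i - |x| y_i gives
    2 |x| |y| (|x| |y| - x . y), which is therefore nonnegative.
    Cancelling |x| |y| leaves only the case where one of the vectors is 0. *)
Lemma cauchy_schwarz (R : realType) (n : nat) (x y : 'cV[R]_n) :
  \sum_(i < n) x i ord0 * y i ord0 <= enorm x * enorm y.
Proof.
set N := enorm x * enorm y; set S := \sum_(i < n) _.
have : 0 <= \sum_(i < n) (enorm y * x i ord0 - enorm x * y i ord0) ^+ 2.
  by apply: sumr_ge0 => i _; exact: sqr_ge0.
have -> : \sum_(i < n) (enorm y * x i ord0 - enorm x * y i ord0) ^+ 2 =
    2 * N * (N - S).
  under eq_bigr do rewrite sqrrB !exprMn.
  rewrite big_split/= sumrB -!mulr_sumr -!enorm_sqr.
  rewrite (eq_bigr (fun i => (2 * N) * (x i ord0 * y i ord0))); last first.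
    by move=> i _; rewrite /N; ring.
  by rewrite -mulr_sumr -/S /N; ring.
have [N0|] := ltP 0 N.
  by rewrite pmulr_rge0 ?subr_ge0// mulr_gt0.
move=> N0 _; have {N0} : enorm x * enorm y == 0.
  by rewrite eq_le N0 mulr_ge0 ?enorm_ge0.
have coord0 (z : 'cV[R]_n) i : enorm z = 0 -> z i ord0 = 0.
  by move=> z0; apply/eqP; rewrite -normr_eq0 eq_le normr_ge0 -{1}z0 coord_le_enorm.
rewrite mulf_eq0 => /orP[] /eqP z0; rewrite /S big1 ?mulr_ge0 ?enorm_ge0// => i _;
  by rewrite (coord0 _ _ z0) (mul0r, mulr0).
Qed.

Lemma enorm_triangle (R : realType) (n : nat) (x y : 'cV[R]_n) :
  enorm (x + y) <= enorm x + enorm y.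
Proof.
rewrite -(@ler_pXn2r _ 2)// ?nnegrE ?addr_ge0 ?enorm_ge0//.
rewrite sqrrD !enorm_sqr.
under eq_bigr do rewrite mxE sqrrD.
rewrite !big_split/= lerD2r lerD2l.
by rewrite mulr2n lerD ?cauchy_schwarz.
Qed.

(** * The limiting error ratio is at most G* *)

Lemma dotvD (R : realType) (n : nat) (u v w : 'cV[R]_n) :
  dotv u (v + w) = dotv u v + dotv u w.
Proof. by rewrite /dotv mulmxDr mxE. Qed.

Lemma dotvB (R : realType) (n : nat) (u v w : 'cV[R]_n) :
  dotv u (v - w) = dotv u v - dotv u w.
Proof. by rewrite /dotv mulmxBr !mxE. Qed.

Lemma dotvZ (R : realType) (n : nat) (a : R) (u v : 'cV[R]_n) :
  dotv u (a *: v) = a * dotv u v.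
Proof. by rewrite /dotv -scalemxAr mxE. Qed.

(** A feasible z with a larger cost would let us go from x a little in the
    direction x - z, staying feasible and lowering the cost. *)
Lemma positive_optimum_all_optimal (R : realType) (m n : nat)
    (A : 'M[R]_(m, n)) (b : 'cV[R]_m) (c x : 'cV[R]_n) :
  Xstar A b c x -> (forall i, 0 < x i ord0) -> Fp A b `<=` Xstar A b c.
Proof.
move=> [[Ax x0] xopt] xpos z Fz; split=> // w Fw.
apply: (le_trans _ (xopt w Fw)).
have [Az z0] := Fz; rewrite leNgt; apply/negP => cxz.
(* The ratios z_i / x_i bound the step along x - z that keeps x_i
   nonnegative; their sum, plus 1 to stay positive, dominates all of them. *)
pose t := (1 + \sum_i z i ord0 / x i ord0)^-1.
have q0 i : 0 <= z i ord0 / x i ord0.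
  by rewrite divr_ge0 ?(ltW (xpos i))//; have := z0 i; rewrite mxE.
have s0 : 0 < 1 + \sum_i z i ord0 / x i ord0.
  by rewrite ltr_pwDl// sumr_ge0.
have t0 : 0 < t by rewrite invr_gt0.
have tz i : t * z i ord0 <= x i ord0.
  rewrite mulrC ler_pdivrMr// mulrC -ler_pdivrMr//.
  by rewrite (bigD1 i)//= addrCA lerDl addr_ge0// sumr_ge0.
have Fp_ext : Fp A b (x + t *: (x - z)).
  split; first by rewrite /Vp/= mulmxDr -scalemxAr mulmxBr Ax Az subrr scaler0 addr0.
  move=> i; rewrite !mxE; have := tz i; have := xpos i => xi tzi.
  by have := mulr_ge0 (ltW t0) (ltW xi); lra.
have := xopt _ Fp_ext.
rewrite dotvD dotvZ dotvB lerDl leNgt => /negP; apply.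
by rewrite pmulr_rlt0// subr_lt0.
Qed.

(** The segment from x to xh enters the orthant no later than at the fraction
    t = d / (r + d), where (1 - t) (- d) + t r = 0. *)
Lemma retract_to_Fp (R : realType) (m n : nat) (A : 'M[R]_(m, n))
    (b : 'cV[R]_m) (x xh : 'cV[R]_n) (r d : R) :
  0 < r -> Vp A b xh -> lev (r *: ones R n) xh ->
  0 <= d -> Vp A b x -> (forall i, - d <= x i ord0) ->
  exists2 z, Fp A b z & enorm (x - z) <= d * (enorm (x - xh) / r).
Proof.
move=> r0 Vxh rxh d0 Vx dx; pose t := d / (r + d).
have rd0 : 0 < r + d by rewrite ltr_wpDr.
have t0 : 0 <= t by rewrite divr_ge0// ltW.
have t1 : t <= 1 by rewrite ler_pdivrMr// mul1r lerDr ltW.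
have tE : t * (r + d) = d by rewrite /t divfK// gt_eqF.
exists (x + t *: (xh - x)).
  split; first by rewrite /Vp/= mulmxDr -scalemxAr mulmxBr Vx Vxh subrr scaler0 addr0.
  move=> i; rewrite !mxE; have := dx i; have := rxh i; rewrite !mxE mulr1 => ri di.
  have -> : x i ord0 + t * (xh i ord0 - x i ord0) =
      t * (xh i ord0 - r) + (1 - t) * (x i ord0 + d) + (t * (r + d) - d) by ring.
  rewrite tE subrr addr0 addr_ge0// mulr_ge0//; lra.
rewrite opprD addNKr -scalerN opprB enormZ ger0_norm// /t.
rewrite mulrCA mulrC ler_wpM2l ?enorm_ge0//.
by rewrite ler_wpM2l// lef_pV2 ?posrE// lerDl.
Qed.

(** The bound [- d <= x i] of [retract_to_Fp] holds for d = Dist(x, orthant):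
    a nonnegative y differs from x by at least - x_i in the i-th entry. *)
Lemma theta_p_le (R : realType) (m n : nat) (A : 'M[R]_(m, n))
    (b : 'cV[R]_m) (x xh : 'cV[R]_n) (r : R) :
  0 < r -> Vp A b xh -> lev (r *: ones R n) xh -> Vp A b x -> ~ Fp A b x ->
  (theta_p A b x <= (enorm (x - xh) / r)%:E)%E.
Proof.
move=> r0 Vxh rxh Vx nFx; rewrite /theta_p memNset//.
have [i xi] : exists i, x i ord0 < 0.
  apply: contrapT => /forallNP xn; apply: nFx; split=> // i.
  by rewrite mxE leNgt; apply/negP/xn.
have lb j : ((- x j ord0)%:E <= Dist x (@orthant R n))%E.
  apply: le_ereal_inf_tmp => _ [y y0 <-]; rewrite lee_fin.
  apply: (le_trans _ (coord_le_enorm _ _ _ j)); rewrite ler_normr !mxE opprB.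
  by apply/orP; right; rewrite lerDr; have := y0 j; rewrite mxE.
have ub : (Dist x (@orthant R n) <= (enorm (x - 0))%:E)%E.
  by apply: ereal_inf_lbound; exists 0 => // j; rewrite mxE.
have : (Dist x (@orthant R n)) \is a fin_num.
  rewrite fin_numE; apply/andP; split; apply/eqP => E.
    by have := lb i; rewrite E.
  by move: ub; rewrite E.
move: lb; case: (Dist x _) => // d lb _.
have {}lb j : - d <= x j ord0 by have := lb j; rewrite lee_fin lerNl.
have d0 : 0 < d by have := lb i; lra.
rewrite inver gt_eqF// lee_pdivrMr//.
have [z Fz zle] := retract_to_Fp _ _ _ A b x xh r d r0 Vxh rxh (ltW d0) Vx lb.
by apply: ge_ereal_inf; exists (enorm (x - z))%:E; [exists z|rewrite -EFinM lee_fin mulrC].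
Qed.

(** Every admissible pair (r, xh) of G* bounds the limiting error ratio: at
    points x outside F_p by [theta_p_le] and the triangle inequality through an
    optimal point close to x, and at points of F_p because the bound is at
    least 1, thanks to an entry of x_a that is not positive. *)
Lemma theta_star_le (R : realType) (m n : nat) (A : 'M[R]_(m, n))
    (b : 'cV[R]_m) (c xa xh : 'cV[R]_n) (Ra r : R) :
  Fp A b `\` Xstar A b c !=set0 -> Xstar A b c xa ->
  Xstar A b c `<=` [set x | enorm (x - xa) <= Ra] ->
  0 < r -> Vp A b xh -> lev (r *: ones R n) xh ->
  (theta_star A b c <= ((Ra + enorm (xh - xa)) / r)%:E)%E.
Proof.
move=> [z [Fz nXz]] Xxa XRa r0 Vxh rxh.
have Ra0 : 0 <= Ra by apply: le_trans (XRa _ Xxa); exact: enorm_ge0.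
have ge1 : 1 <= (Ra + enorm (xh - xa)) / r.
  have [i xai] : exists i, xa i ord0 <= 0.
    apply: contrapT => /forallNP xan; apply: nXz.
    apply: (positive_optimum_all_optimal _ _ _ A b c xa) => // i.
    by rewrite ltNge; apply/negP/xan.
  rewrite ler_pdivlMr// mul1r; apply: (le_trans _ (ler_wpDl Ra0 (lexx _))).
  apply: (le_trans _ (coord_le_enorm _ _ _ i)).
  apply: (le_trans _ (ler_norm _)); have := rxh i; rewrite !mxE mulr1; lra.
apply/lee_addgt0Pr => e e0; apply: lime_le; first exact: is_cvg_theta_sup.
(* 2 * eps / r is at most e once eps is below this threshold. *)
have er0 : 0 < e * r / 2 by rewrite divr_gt0// mulr_gt0.
near=> eps.
have eps0 : 0 < eps by [].
apply: ge_ereal_sup => _ [x [Vx xX] <-].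
have [Fx|nFx] := pselect (Fp A b x).
  rewrite /theta_p mem_set// -EFinD lee_fin.
  by apply: (le_trans ge1); rewrite lerDl ltW.
apply: (le_trans (theta_p_le _ _ _ A b x xh r r0 Vxh rxh Vx nFx)).
rewrite -EFinD lee_fin -[e](@mulfK _ r) ?gt_eqF// -mulrDl ler_pM2r ?invr_gt0//.
(* The distance need not be attained, hence the slack factor 2. *)
have /ereal_inf_lt[_ [x' Xx' <-]] : (Dist x (Xstar A b c) < (2 * eps)%:E)%E.
  by apply: (le_lt_trans xX); rewrite lte_fin ltr_pMl// ltr1n.
rewrite lte_fin => xx'.
have eps_lt : eps < e * r / 2 by [].
have -> : x - xh = (x - x') + ((x' - xa) + (xa - xh)) by rewrite !subrKA.
apply: (le_trans (enorm_triangle _ _ _ _)).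
have := enorm_triangle _ _ (x' - xa) (xa - xh).
have := XRa _ Xx'; rewrite /= (enormB_sym _ _ xa xh); lra.
Unshelve. all: by end_near. Qed.

(** * G* as a minimum *)

(** One inequality is the substitution alpha = 1 / r, v = x / r; only the points
    with alpha = 0 are not of this form, and they are limits. *)
Lemma Gstar_inf_min_values (R : realType) (m n : nat) (A : 'M[R]_(m, n))
    (b : 'cV[R]_m) (xa : 'cV[R]_n) (Ra : R) :
  0 <= Ra -> Fp A b xa ->
  Gstar A b xa Ra = ereal_inf (Gstar_min_values A b xa Ra).
Proof.
move=> Ra0 [Axa xa0]; apply/eqP; rewrite eq_le; apply/andP; split; last first.
  apply: ereal_inf_le_tmp => _ [r [x [r0 Vx rx ->]]].
  exists (r^-1 *: x), r^-1; split.
  - by rewrite -scalemxAr Vx.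
  - move=> i; have := rx i; rewrite !mxE mulr1 => ri.
    by rewrite mulrC ler_pdivlMr// mul1r.
  - by rewrite invr_ge0 ltW.
  - by rewrite -scalerBr enormZ ger0_norm ?invr_ge0 1?ltW// mulrDl [_^-1 * _]mulrC.
apply: le_ereal_inf_tmp => _ [v [al [Av v1 al0 ->]]].
move: al0; rewrite [in X in X -> _]le_eqVlt => /predU1P[al0|al0]; last first.
  apply: ereal_inf_lbound; exists al^-1, (al^-1 *: v); split.
  - by rewrite invr_gt0.
  - by rewrite /Vp/= -scalemxAr Av scalerA mulVf ?gt_eqF// scale1r.
  - by move=> i; rewrite !mxE ler_pM2l ?invr_gt0//; have := v1 i; rewrite mxE.
  - rewrite invrK mulrDl; congr (_ + _)%:E.
    have -> : v - al *: xa = al *: (al^-1 *: v - xa).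
      by rewrite scalerBr scalerA mulfV ?gt_eqF// scale1r.
    by rewrite enormZ gtr0_norm// mulrC.
subst al; move: Av; rewrite !scale0r subr0 mulr0 add0r => Av.
(* Here A v = 0, and xa + t v has value Ra / t + |v|; this t makes
   Ra / t less than e. *)
apply/lee_addgt0Pr => e e0; pose t := Ra / e + 1.
have t0 : 0 < t by rewrite ltr_wpDl// divr_ge0// ltW.
apply: (@le_trans _ _ ((Ra + enorm ((xa + t *: v) - xa)) / t)%:E).
  apply: ereal_inf_lbound; exists t, (xa + t *: v); split=> //.
  - by rewrite /Vp/= mulmxDr -scalemxAr Av scaler0 addr0.
  - move=> i; rewrite !mxE ler_wpDl//; first by have := xa0 i; rewrite mxE.
    by rewrite ler_pM2l//; have := v1 i; rewrite mxE.
rewrite -EFinD lee_fin addrAC subrr add0r enormZ gtr0_norm//.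
have te : t * e = Ra + e by rewrite /t mulrDl mul1r divfK ?gt_eqF.
by rewrite ler_pdivrMr//; lra.
Qed.

Lemma closed_preimage_ge0 (R : realType) (T : topologicalType) (f : T -> R) :
  continuous f -> closed [set u | 0 <= f u].
Proof.
move=> cf; apply: (@preimage_closed _ _ f [set y | 0 <= y]).
  by move=> x _; exact: cf.
exact: closed_ge.
Qed.

Lemma continuous_sumr (R : realType) (T : topologicalType) (I : Type)
    (s : seq I) (f : I -> T -> R) :
  (forall i, continuous (f i)) -> continuous (fun u => \sum_(i <- s) f i u).
Proof.
move=> cf; elim: s => [|i s IHs] u.
  under eq_fun do rewrite big_nil; exact: cvg_cst.
by under eq_fun do rewrite big_cons; apply: cvgD; [exact: cf|exact: IHs].
Qed.

(** The minimization is over rows u with alpha in entry 0 and w = v - alpha x_a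
    in the other entries.  Bounding alpha by K keeps the argument uniform in
    R_a >= 0: for R_a = 0 the set of minimizers may be unbounded, but it meets
    the box. *)
Lemma Gstar_min_attained (R : realType) (m n : nat) (A : 'M[R]_(m, n))
    (b : 'cV[R]_m) (xa : 'cV[R]_n) (Ra : R) :
  0 <= Ra -> Fp A b xa -> Gstar_min_values A b xa Ra !=set0 ->
  exists2 g, Gstar_min_values A b xa Ra g & lbound (Gstar_min_values A b xa Ra) g.
Proof.
move=> Ra0 [Axa xa0] [_ [v0 [al0 [Av0 v01 al00 _]]]].
have {}xa0 i : 0 <= xa i ord0 by have := xa0 i; rewrite mxE.
pose obj (v : 'cV[R]_n) al := Ra * al + enorm (v - al *: xa).
pose M := obj v0 al0.
have M0 : 0 <= M by rewrite addr_ge0 ?enorm_ge0// mulr_ge0.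
(* As 0^-1 = 0, the sum runs over the positive entries of xa.  At these,
   K * xa_i >= 1 + M, which makes up for w_i >= - M. *)
pose K := (1 + M) * \sum_i (xa i ord0)^-1.
have K0 : 0 <= K.
  apply: mulr_ge0; first by rewrite addr_ge0.
  by apply: sumr_ge0 => i _; rewrite invr_ge0.
pose w (u : 'rV[R]_n.+1) : 'cV[R]_n := \col_i u ord0 (lift ord0 i).
pose al (u : 'rV[R]_n.+1) : R := u ord0 ord0.
pose f u := Ra * al u + enorm (w u).
pose box : set 'rV[R]_n.+1 :=
  [set u | forall j, `[- (K + M), K + M]%classic (u ord0 j)].
pose feas : set 'rV[R]_n.+1 :=
  [set u | [/\ forall k, (A *m w u) k ord0 = 0, 0 <= al u
             & forall i, 1 <= w u i ord0 + al u * xa i ord0]].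
(* Replacing alpha by min alpha K loses no constraint: where xa_i = 0, alpha
   is irrelevant, and where xa_i > 0, the value K already suffices. *)
have reduce v a : A *m v = a *: b -> lev (ones R n) v -> 0 <= a ->
    obj v a <= M -> exists2 u, (box `&` feas) u & f u <= obj v a.
  move=> Av v1 a0 objM.
  have nM : enorm (v - a *: xa) <= M.
    by apply: le_trans objM; rewrite lerDr mulr_ge0.
  pose a' := Num.min a K.
  have a'0 : 0 <= a' by rewrite le_min a0.
  pose u : 'rV[R]_n.+1 :=
    \row_j if unlift ord0 j is Some i then (v - a *: xa) i ord0 else a'.
  have wu : w u = v - a *: xa.
    by apply/colP => i; rewrite !mxE liftK !mxE.
  have alu : al u = a' by rewrite /al mxE unlift_none.
  exists u; last first.
    by rewrite /f wu alu lerD2r ler_wpM2l// ge_min lexx.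
  split.
    move=> j; rewrite /= in_itv/= -ler_norml.
    have [i ->|->] := unliftP ord0 j.
      rewrite [u _ _](_ : _ = w u i ord0); last by rewrite [RHS]mxE.
      by rewrite wu (le_trans (coord_le_enorm _ _ _ _))// (le_trans nM)// lerDr.
    by rewrite -/(al u) alu ger0_norm// ge_min (_ : K <= _) ?orbT// lerDl.
  split.
  - by move=> k; rewrite wu mulmxBr -scalemxAr Av Axa subrr mxE.
  - by rewrite alu.
  move=> i; rewrite wu alu /a'; have [_|Ka] := leP a K.
    by rewrite !mxE subrK; have := v1 i; rewrite mxE.
  have [xi0|xi0] := eqVneq (xa i ord0) 0.
    by have := v1 i; rewrite !mxE xi0 !mulr0 subr0 addr0.
  have xip : 0 < xa i ord0 by rewrite lt_neqAle eq_sym xi0 xa0.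
  have : 1 + M <= K * xa i ord0.
    rewrite -ler_pdivrMr// /K ler_pM2l ?ltr_pwDl//.
    rewrite (bigD1 i)//= lerDl.
    by rewrite sumr_ge0// => j _; rewrite invr_ge0.
  have := coord_le_enorm _ _ (v - a *: xa) i; rewrite ler_norml => /andP[]; lra.
have cw i : continuous (fun u => w u i ord0).
  move=> u; under eq_fun do rewrite mxE; exact: coord_continuous.
have cal : continuous al by exact: coord_continuous.
have cf : continuous f.
  have cN : continuous (fun u => enorm (w u)).
    move=> u.
    apply: (@continuous_comp _ _ _ (fun u => \sum_i w u i ord0 ^+ 2) Num.sqrt);
      last exact: sqrt_continuous.
    by apply: continuous_sumr => i {}u; exact: (continuousM (cw i u) (cw i u)).
  move=> u; have cRal := continuousM (@cst_continuous _ _ Ra u) (cal u).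
  by have := continuousD cRal (cN u); exact.
have boxC : compact box.
  apply: (@rV_compact _ _ (fun=> `[- (K + M), K + M]%classic)) => j.
  exact: segment_compact.
have cA k : continuous (fun u => (A *m w u) k ord0).
  move=> u; under eq_fun do rewrite mxE.
  apply: continuous_sumr => i {}u.
  exact: (continuousM (@cst_continuous _ _ (A k i) u) (cw i u)).
have feasC : closed feas.
  have -> : feas = (\bigcap_k [set u | (A *m w u) k ord0 = 0]) `&`
      [set u | 0 <= al u] `&`
      (\bigcap_i [set u | 0 <= w u i ord0 + al u * xa i ord0 - 1]).
    apply/seteqP; split=> u.
      by move=> [h1 h2 h3]; split; [split=> // k _; exact: h1|];
        move=> i _ /=; rewrite subr_ge0.
    move=> [[h1 h2] h3]; split=> // [k|i]; first exact: h1.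
    by rewrite -subr_ge0; exact: (h3 i I).
  apply: closedI; first apply: closedI; last first.
  - apply: closed_bigI => i _; apply: closed_preimage_ge0 => u.
    have calx := continuousM (cal u) (@cst_continuous _ _ (xa i ord0) u).
    have cwx := continuousD (cw i u) calx.
    by have := continuousB cwx (@cst_continuous _ R 1 u); exact.
  - exact: closed_preimage_ge0.
  apply: closed_bigI => k _.
  apply: (@preimage_closed _ _ (fun u => (A *m w u) k ord0) [set y | y = 0]).
    by move=> u _; exact: cA.
  exact: closed_eq.
have [u0 Su0 fu0] := reduce v0 al0 Av0 v01 al00 (lexx M).
have [us] := @EVT_min_rV R n.+1 f (box `&` feas) (ex_intro _ u0 Su0)
  (compact_closedI boxC feasC) (continuous_subspaceT cf).
rewrite inE => -[_ [Aus alus usx]] usmin.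
exists (f us)%:E.
  exists (w us + al us *: xa), (al us); split=> //.
  - rewrite mulmxDr -scalemxAr Axa; apply/colP => k.
    by rewrite mxE Aus add0r.
  - by move=> i; have := usx i; rewrite !mxE.
  - by rewrite addrK.
move=> _ [v [a [Av v1 a0 ->]]]; rewrite lee_fin -/(obj v a).
have [/(reduce v a Av v1 a0)[u Su fu]|Mlt] := leP (obj v a) M.
  by apply: le_trans fu; apply: usmin; rewrite inE.
apply: (le_trans _ (ltW Mlt)); apply: le_trans fu0.
by apply: usmin; rewrite inE.
Qed.

Theorem proposition4p2 (R : realType) (m n : nat) (A : 'M[R]_(m, n))
    (b : 'cV[R]_m) (c : 'cV[R]_n) (xa : 'cV[R]_n) (Ra : R)
    (hLP : lp_assumption A b c)
    (hxa : Xstar A b c xa)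
    (hRa : Xstar A b c `<=` [set x | enorm (x - xa) <= Ra]) :
  (theta_star A b c <= Gstar A b xa Ra)%E /\
  is_emin (Gstar_min_values A b xa Ra) (Gstar A b xa Ra).
Proof.
have [_ hnonopt _] := hLP; split.
  apply: le_ereal_inf_tmp => _ [r [x [r0 Vx rx ->]]].
  exact: theta_star_le hRa r0 Vx rx.
have Ra0 : 0 <= Ra by apply: le_trans (hRa _ hxa); exact: enorm_ge0.
have [Fxa _] := hxa; rewrite Gstar_inf_min_values//.
have [S0|/set0P/(Gstar_min_attained _ _ _ _ _ _ _ Ra0 Fxa)[g Sg lg]] :=
  eqVneq (Gstar_min_values A b xa Ra) set0.
  by left; rewrite S0 ereal_inf0.
right; suff -> : ereal_inf (Gstar_min_values A b xa Ra) = g by [].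
by apply/eqP; rewrite eq_le ereal_inf_lbound//= le_ereal_inf_tmp.
Qed.
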